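(* Let $X\in\mathbb{R}^{m\times n}$ with $\operatorname{rank}(X)=r\le d$, and let $0<p\le 1$, $p_1>0$, $p_2>0$ satisfy $1/p_1+1/p_2=1/p$. Then \[ \|X\|_{S_p}=\min_{X=UV^{T}}\|U\|_{S_{p_1}}\|V\|_{S_{p_2}} =\min_{X=UV^{T}}\left(\frac{p_2\|U\|_{S_{p_1}}^{p_1}+p_1\|V\|_{S_{p_2}}^{p_2}}{p_1+p_2}\right)^{1/p} =\min_{X=UV^{T}}\left(\frac{\|U\|_{S_{p_1}}^{p_1}/p_1+\|V\|_{S_{p_2}}^{p_2}/p_2}{1/p}\right)^{1/p}, \] where each minimum is over $U\in\mathbb{R}^{m\times d}$, $V\in\mathbb{R}^{n\times d}$ with $X=UV^{T}$, and each minimum is attained.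
   Context: For $0<q<\infty$ and a real matrix $Y$ with singular values $\sigma_1(Y),\dots,\sigma_k(Y)$ ($k$ the smaller dimension of $Y$), the Schatten-$q$ (quasi-)norm is $\|Y\|_{S_q}=\left(\sum_{i=1}^{k}\sigma_i(Y)^q\right)^{1/q}$. *)

(* Defs.v *)
From HB Require Import structures.
From mathcomp Require Import all_boot all_order all_algebra.
From mathcomp Require Import boolp reals exp.
Set Implicit Arguments. Unset Strict Implicit. Unset Printing Implicit Defensive.
Import Order.TTheory GRing.Theory Num.Theory.
Local Open Scope ring_scope.

Definition rdiag_mx (R : pzRingType) (m n : nat) (s : 'I_(minn m n) -> R)
  : 'M[R]_(m, n) :=
  \matrix_(i < m, j < n)
    (if (i == j :> nat) then
       (match @insub _ (fun k => (k < minn m n)%N) 'I_(minn m n) (val i) with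
        | Some k => s k | None => 0 end)
     else 0).

Definition svals_spec (R : realType) (m n : nat) (X : 'M[R]_(m, n))
  (s : 'I_(minn m n) -> R) : Prop :=
  (forall i, 0 <= s i) /\
  exists (P : 'M[R]_m) (Q : 'M[R]_n),
    P^T *m P = 1%:M /\ Q^T *m Q = 1%:M /\ X = P *m rdiag_mx s *m Q^T.

(* singular values sigma_1(X), ..., sigma_k(X), k = min(m,n)
   (chosen through an SVD; the default branch is never used since every real
   matrix has an SVD). *)
Definition svals (R : realType) (m n : nat) (X : 'M[R]_(m, n))
  : 'I_(minn m n) -> R :=
  match pselect (exists s, svals_spec X s) with
  | left h => proj1_sig (cid h)
  | right _ => fun _ => 0
  end.

Definition schatten (R : realType) (q : R) (m n : nat) (X : 'M[R]_(m, n)) : R :=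
  (\sum_(i < minn m n) (svals X i) `^ q) `^ (1 / q).

Definition factor_min (R : realType) (m n d : nat) (X : 'M[R]_(m, n))
  (f : 'M[R]_(m, d) -> 'M[R]_(n, d) -> R) (v : R) : Prop :=
  (exists (U : 'M[R]_(m, d)) (V : 'M[R]_(n, d)), X = U *m V^T /\ f U V = v) /\
  (forall (U : 'M[R]_(m, d)) (V : 'M[R]_(n, d)), X = U *m V^T -> v <= f U V).
Arguments factor_min {R m n} d X f v.

(* Main.v *)
(** Singular values enter only through the sums of their powers.  If B is
    orthogonal, the squared norms of the columns of X B are the image of the
    squared singular values of X under a doubly stochastic matrix, so Jensen's
    inequality compares the sum of their (q/2)-th powers with the q-th power sum
    of the singular values: from above for q <= 2, from below for q >= 2.  Hence
    power sums do not depend on the chosen decomposition.  Taking for B the right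
    singular vectors of Y, Hoelder's inequality gives
    |W Y|_p <= |W|_q |Y|_r whenever p <= 2 <= q and 1/p = 1/q + 1/r.
    For a left exponent below 2, U is factored through fractional powers of its
    singular values and the factors are absorbed one at a time; transposition
    covers a right exponent above 2.
    Equality is reached by distributing the singular values of X as
    f^(p/p1) and f^(p/p2), and the two mean forms follow from Young's inequality. *)
Require Import Defs.
From HB Require Import structures.
From mathcomp Require Import all_boot all_order all_algebra.
From mathcomp Require Import sesquilinear spectral complex.
From mathcomp Require Import boolp reals exp ring lra.
Set Implicit Arguments. Unset Strict Implicit. Unset Printing Implicit Defensive.
Import Order.TTheory GRing.Theory Num.Theory.
Local Open Scope ring_scope.

(** * Real symmetric matrices: a nonzero eigenvalue *)

Lemma symmetric_eigenvalue_neq0 (R : rcfType) n (G : 'M[R]_n) :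
  G^T = G -> G != 0 -> exists2 a, a != 0 & eigenvalue G a.
Proof.
(* Over the complex numbers [G] becomes Hermitian, so it is unitarily diagonalizable with a real
   spectrum; a nonzero spectral entry then descends to the real field. *)
move=> Gsym Gn0; pose GC := map_mx (@real_complex_def R (Phant R)) G.
have GCr : GC \is a mxOver Num.real.
  by apply/mxOverP => i j; rewrite mxE complex_real.
have GCh : GC \is hermsymmx.
  apply/is_hermitianmxP; rewrite scale1r.
  by apply/matrixP => i j; rewrite !mxE -[in LHS]Gsym mxE conj_Creal // complex_real.
have /orthomx_spectralP eGC := hermitian_normalmx GCh.
have spr := hermitian_spectral_diag_real GCh.
have [i si] : exists i, spectral_diag GC 0 i != 0.
  apply/existsP; apply: contraNT Gn0 => /existsPn s0.
  have sd0 : spectral_diag GC = 0.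
    by apply/rowP => i; rewrite mxE; apply/eqP; move: (s0 i); rewrite negbK.
  have : GC == 0 by rewrite eGC sd0 raddf0 mulmx0 mul0mx.
  by rewrite /GC map_mx_eq0.
have := mxOverP spr 0 i => /complex_realP[a ea]; exists a.
  by apply: contraNneq si => a0; rewrite ea a0.
rewrite -(eigenvalue_map (@real_complex_def R (Phant R))) /= -ea.
apply/eigenvalueP.
have Pu := spectral_unit GC.
(* Rows of the diagonalizing matrix are left eigenvectors, and none is zero because that matrix is
   invertible. *)
exists (row i (spectralmx GC)).
  rewrite [X in _ *m X]eGC -row_mul !mulmxA mulmxV // mul1mx.
  by rewrite row_mul row_diag_mx -scalemxAl rowE.
apply/eqP => r0.
have : (delta_mx 0 i : 'rV_n) *m spectralmx GC *m invmx (spectralmx GC) = 0.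
  by rewrite -rowE r0 mul0mx.
rewrite mulmxK // => /matrixP/(_ 0 i)/eqP; rewrite !mxE !eqxx oner_eq0 //.
Qed.

(** * Orthogonal matrices and reflections *)

Definition orthogonal_mx (R : pzRingType) n (P : 'M[R]_n) := P^T *m P = 1%:M.

Lemma orthogonal_mx1 (R : comUnitRingType) n : orthogonal_mx (1%:M : 'M[R]_n).
Proof. by rewrite /orthogonal_mx trmx1 mulmx1. Qed.

Lemma orthogonal_mxC (R : comUnitRingType) n (P : 'M[R]_n) :
  orthogonal_mx P -> P *m P^T = 1%:M.
Proof. exact: mulmx1C. Qed.

Lemma orthogonal_mx_unit (R : comUnitRingType) n (P : 'M[R]_n) :
  orthogonal_mx P -> P \in unitmx.
Proof. by move=> /orthogonal_mxC/mulmx1_unit[]. Qed.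

Lemma orthogonal_trmx (R : comUnitRingType) n (P : 'M[R]_n) :
  orthogonal_mx P -> orthogonal_mx P^T.
Proof. by rewrite /orthogonal_mx trmxK; exact: mulmx1C. Qed.

Lemma orthogonal_mulmx (R : comUnitRingType) n (P Q : 'M[R]_n) :
  orthogonal_mx P -> orthogonal_mx Q -> orthogonal_mx (P *m Q).
Proof.
by rewrite /orthogonal_mx => oP oQ; rewrite trmx_mul mulmxA -(mulmxA Q^T) oP mulmx1.
Qed.

Lemma orthogonal_block1 (R : comUnitRingType) n (P : 'M[R]_n) :
  orthogonal_mx P -> orthogonal_mx (block_mx (1%:M : 'M_1) 0 0 P).
Proof.
move=> oP; rewrite /orthogonal_mx tr_block_mx !trmx0 trmx1 mulmx_block.
by rewrite !mulmx0 !mul0mx !addr0 add0r mulmx1 oP -scalar_mx_block.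
Qed.

Lemma mx11_mul_tr (R : comPzRingType) n (v : 'cV[R]_n) :
  v^T *m v = (\sum_i v i 0 ^+ 2)%:M.
Proof.
rewrite [LHS]mx11_scalar mxE; congr (_%:M).
by apply: eq_bigr => i _; rewrite mxE expr2.
Qed.

Lemma sum_sqr_gt0 (R : realFieldType) n (v : 'cV[R]_n) :
  v != 0 -> 0 < \sum_i v i 0 ^+ 2.
Proof.
move=> v0; rewrite lt_def sumr_ge0 ?andbT; last by move=> i _; exact: sqr_ge0.
apply: contraNneq v0 => s0; apply/eqP/colP => i; rewrite mxE.
apply/eqP; rewrite -sqrf_eq0; apply/eqP; move: i (erefl true).
by apply: (psumr_eq0P _ s0) => i _; exact: sqr_ge0.
Qed.

(* Householder reflection along [u - e_0]. *)
Lemma orthogonal_first_col (R : realFieldType) n (u : 'cV[R]_n.+1) :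
  u^T *m u = 1%:M -> exists2 P, orthogonal_mx P & P *m delta_mx 0 0 = u.
Proof.
move=> u1; set e : 'cV_n.+1 := delta_mx 0 0.
have [ue|ue] := eqVneq u e.
  by exists 1%:M; [exact: orthogonal_mx1|rewrite mul1mx ue].
pose w := u - e; pose c := \sum_i w i 0 ^+ 2.
have c0 : c != 0 by rewrite gt_eqF // sum_sqr_gt0 // subr_eq0.
have wwc : w^T *m w = c%:M by rewrite mx11_mul_tr.
have ee : e^T *m e = 1%:M.
  by rewrite /e trmx_delta mul_delta_mx; apply/matrixP => i j; rewrite !ord1 !mxE !eqxx.
pose t := u 0 0.
have ete : e^T *m u = t%:M.
  rewrite /e trmx_delta -rowE; apply/matrixP => i j.
  by rewrite !ord1 !mxE eqxx mulr1n.
have ute : u^T *m e = t%:M by rewrite -[LHS]trmxK trmx_mul trmxK ete tr_scalar_mx.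
(* Both [u] and [e] are unit vectors, so the squared length of their difference depends only on
   their inner product [t]. This makes the reflection send [e] to [u]. *)
have wwE : c = 2 - 2 * t.
  have : w^T *m w = (2 - 2 * t)%:M.
    rewrite /w [(_ - _)^T]linearB /= mulmxBl !mulmxBr u1 ee ute ete.
    apply/matrixP => i j; rewrite !ord1 !mxE eqxx !mulr1n; ring.
  by rewrite wwc => /matrixP/(_ 0 0); rewrite !mxE eqxx !mulr1n.
exists (1%:M - (2 / c) *: (w *m w^T)).
  set W := w *m w^T.
  have WW : W *m W = c *: W.
    by rewrite /W mulmxA -(mulmxA w) wwc mul_mx_scalar -scalemxAl.
  have WT : W^T = W by rewrite /W trmx_mul trmxK.
  rewrite /orthogonal_mx [(_ - _)^T]linearB /= [(_ *: _)^T]linearZ /= trmx1 WT.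
  rewrite mulmxBl mul1mx mulmxBr mulmx1 -scalemxAl -scalemxAr WW !scalerA.
  rewrite -[RHS]addr0 -addrA; congr (_ + _).
  rewrite -opprD -scalerBl -scalerDl.
  by rewrite (_ : _ + _ = 0) ?scale0r ?oppr0 //; field.
have -> : (1%:M - (2 / c) *: (w *m w^T)) *m e = e - (2 / c) *: (w *m (w^T *m e)).
  by rewrite mulmxBl mul1mx -scalemxAl -mulmxA.
have -> : w^T *m e = (t - 1)%:M.
  by rewrite /w [(_ - _)^T]linearB /= mulmxBl ute ee -raddfB.
rewrite mul_mx_scalar scalerA.
have -> : 2 / c * (t - 1) = -1.
  apply: (mulfI c0); rewrite mulrA (mulrC c) divfK // wwE; ring.
by rewrite scaleN1r opprK /w addrC subrK.
Qed.

(** * Rectangular diagonal matrices and singular value decompositions *)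

Definition sdiag (R : pzRingType) m n (f : nat -> R) : 'M[R]_(m, n) :=
  \matrix_(i, j) (f i *+ (i == j :> nat)).

Lemma tr_sdiag (R : pzRingType) m n (f : nat -> R) : (sdiag m n f)^T = sdiag n m f.
Proof. by apply/matrixP => i j; rewrite !mxE eq_sym; case: eqP => // ->. Qed.

Lemma eq_sdiag (R : pzRingType) m n (f g : nat -> R) :
  (forall i, (i < minn m n)%N -> f i = g i) -> sdiag m n f = sdiag m n g.
Proof.
move=> fg; apply/matrixP => i j; rewrite !mxE.
by case: eqP => // ij; rewrite fg // leq_min ltn_ord ij ltn_ord.
Qed.

(** The inner dimension [n] cuts the product off: entries from [n] on are lost, so the formula needs
    [f i * g i] to vanish there. *)
Lemma mul_sdiag (R : pzRingType) m n k (f g : nat -> R) :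
  (forall i, (n <= i)%N -> f i * g i = 0) ->
  sdiag m n f *m sdiag n k g = sdiag m k (fun i => f i * g i).
Proof.
move=> fg0; apply/matrixP => i j; rewrite !mxE.
under eq_bigr do rewrite !mxE mulrnAl mulrnAr.
have [ni|ni] := ltnP i n.
  rewrite (bigD1 (Ordinal ni)) //= eqxx big1 ?addr0 // => l li.
  by rewrite [i == l :> nat](_ : _ = false) // eq_sym; exact: negbTE.
rewrite fg0 // mul0rn big1 // => l _.
by rewrite [i == l :> nat]gtn_eqF ?mulr0n // (leq_trans _ ni).
Qed.

Lemma mul_mx_sdiag (R : pzRingType) m n (A : 'M[R]_(m, n)) f i j :
  (A *m sdiag n n f) i j = A i j * f j.
Proof.
rewrite mxE (bigD1 j) //= mxE eqxx big1 ?addr0 // => l lj.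
by rewrite mxE val_eqE (negbTE lj) mulr0.
Qed.

(** Replacing the zeros of [f] by 1 gives an invertible diagonal matrix; the given matrix is its
    product with [pid_mx r]. *)
Lemma mxrank_sdiag (F : fieldType) m n (f : nat -> F) r :
  (r <= m)%N -> (r <= n)%N -> (forall i, (f i != 0) = (i < r)%N) ->
  \rank (sdiag m n f) = r.
Proof.
move=> rm rn fr; pose g i := if (i < r)%N then f i else 1.
have -> : sdiag m n f = sdiag m m g *m pid_mx r.
  have -> : pid_mx r = sdiag m n (fun i => (i < r)%:R) :> 'M[F]_(m, n).
    by apply/matrixP => i j; rewrite !mxE; case: eqP.
  rewrite mul_sdiag => [|i mi]; last by rewrite ltnNge (leq_trans rm mi) mulr0.
  apply: eq_sdiag => i _; rewrite /g; case: ifPn => [|ri]; rewrite ?mulr1 ?mulr0 //.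
  by apply/eqP; rewrite -[_ == _]negbK fr.
rewrite eqmxMfull ?rank_pid_mx // row_full_unit.
apply: (proj1 (mulmx1_unit (_ : _ *m sdiag m m (fun i => (g i)^-1) = 1%:M))).
apply/matrixP => i j; rewrite mul_mx_sdiag !mxE val_eqE.
case: eqP => [->|]; rewrite ?mul0r // divff // /g.
by case: ifPn => [|_]; rewrite ?fr ?oner_eq0.
Qed.

Definition is_svd (R : numDomainType) m n (X : 'M[R]_(m, n)) P (f : nat -> R) Q :=
  [/\ orthogonal_mx P, orthogonal_mx Q, forall i, 0 <= f i,
      forall i, (minn m n <= i)%N -> f i = 0 & X = P *m sdiag m n f *m Q^T].

Lemma is_svd_tr (R : numDomainType) m n (X : 'M[R]_(m, n)) P f Q :
  is_svd X P f Q -> is_svd X^T Q f P.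
Proof.
case=> oP oQ f0 fm ->; split=> //; first by move=> i; rewrite minnC; exact: fm.
by rewrite !trmx_mul trmxK tr_sdiag mulmxA.
Qed.

Lemma unit_eigenvector (R : rcfType) n (G : 'M[R]_n) a : eigenvalue G a ->
  exists2 v : 'cV_n, v^T *m v = 1%:M & v^T *m G = a *: v^T.
Proof.
case/eigenvalueP => v vG v0; pose c := \sum_i v^T i 0 ^+ 2.
have c0 : 0 < c by apply: sum_sqr_gt0; rewrite trmx_eq0.
exists ((Num.sqrt c)^-1 *: v^T).
  rewrite [(_ *: _)^T]linearZ /= -scalemxAl -scalemxAr mx11_mul_tr scalerA -/c -invfM -expr2.
  by rewrite sqr_sqrtr 1?ltW // -[RHS]scalemx1 -scalemx1 scalerA mulVf ?scale1r ?gt_eqF.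
by rewrite [(_ *: _)^T]linearZ /= trmxK -scalemxAl vG scalerA mulrC -scalerA.
Qed.

(** Induction on the number of rows, splitting off one nonzero singular value at a time until the
    remainder is zero. Hence the nonzero values come first; [r] records their number, which later
    turns out to be the rank. *)
Lemma svd_exists (R : rcfType) m n (X : 'M[R]_(m, n)) :
  exists r P f Q, is_svd X P f Q /\ forall i, (f i != 0) = (i < r)%N.
Proof.
elim: m n X => [|m IHm] n X.
  exists 0%N, 1%:M, (fun=> 0), 1%:M; split=> [|i]; rewrite ?eqxx //.
  by split=> //; [exact: orthogonal_mx1|exact: orthogonal_mx1|apply/matrixP => -[]].
have [->|X0] := eqVneq X 0.
  exists 0%N, 1%:M, (fun=> 0), 1%:M; split=> [|i]; rewrite ?eqxx //.
  split=> //; [exact: orthogonal_mx1|exact: orthogonal_mx1|].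
  by rewrite trmx1 mul1mx mulmx1; apply/matrixP => i j; rewrite !mxE mul0rn.
case: n X X0 => [|n] X X0; first by case/eqP: X0; apply/matrixP => i [].
(* [X^T *m X] is nonzero because its diagonal holds the squared norms of the columns of [X]. *)
have [a a0 /unit_eigenvector[v v1 vG]] : exists2 a, a != 0 & eigenvalue (X^T *m X) a.
  apply: symmetric_eigenvalue_neq0; first by rewrite trmx_mul trmxK.
  apply: contraNneq X0 => G0; apply/eqP/matrixP => i j; rewrite mxE.
  have /eqP : (X^T *m X) j j = 0 by rewrite G0 mxE.
  rewrite mxE; under eq_bigr do rewrite mxE -expr2.
  rewrite psumr_eq0 => [|k _]; last exact: sqr_ge0.
  by move=> /allP/(_ i (mem_index_enum _)); rewrite sqrf_eq0 => /eqP.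
have aE : (X *m v)^T *m (X *m v) = a%:M.
  by rewrite trmx_mul !mulmxA -(mulmxA _ X^T) vG -scalemxAl v1 scalemx1.
have a_gt0 : 0 < a.
  rewrite lt_def a0; move: aE; rewrite mx11_mul_tr => /matrixP/(_ 0 0).
  by rewrite !mxE eqxx !mulr1n => <-; apply: sumr_ge0 => i _; exact: sqr_ge0.
pose s := Num.sqrt a; have s_gt0 : 0 < s by rewrite sqrtr_gt0.
have s0 : s != 0 by rewrite gt_eqF.
have ss : s * s = a by rewrite -expr2 sqr_sqrtr // ltW.
pose u := s^-1 *: (X *m v).
have u1 : u^T *m u = 1%:M.
  rewrite /u [(_ *: _)^T]linearZ /= -scalemxAl -scalemxAr aE !scale_scalar_mx.
  by rewrite mulrA -invfM ss mulVf.
have [P0 oP0 P0u] := orthogonal_first_col u1.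
have [Q0 oQ0 Q0v] := orthogonal_first_col v1.
(* Since [u] and [v] are the first columns of [P0] and [Q0], the first row and column of
   [P0^T *m X *m Q0] vanish outside the corner entry [s]. *)
have Y0 : (P0^T *m X *m Q0) *m delta_mx 0 0 = s *: delta_mx 0 0 :> 'cV_m.+1.
  rewrite -!mulmxA Q0v (_ : X *m v = s *: u); last by rewrite scalerA divff ?scale1r.
  by rewrite -P0u -scalemxAr mulmxA oP0 mul1mx.
have Y0r : delta_mx 0 0 *m (P0^T *m X *m Q0) = s *: delta_mx 0 0 :> 'rV_n.+1.
  have -> : delta_mx 0 0 *m (P0^T *m X *m Q0) = u^T *m X *m Q0.
    by rewrite -P0u trmx_mul trmx_delta !mulmxA.
  rewrite /u [(_ *: _)^T]linearZ /= trmx_mul -!scalemxAl -(mulmxA _ X^T) vG.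
  rewrite -scalemxAl scalerA -Q0v trmx_mul trmx_delta -mulmxA oQ0 mulmx1.
  by rewrite -ss mulrA mulVf ?mul1r.
pose Y : 'M_(1 + m, 1 + n) := P0^T *m X *m Q0.
have YE : Y = block_mx s%:M 0 0 (drsubmx Y).
  rewrite -[LHS]submxK; congr block_mx.
  - apply/matrixP => i j; rewrite !ord1 mxE mxE [RHS]mxE eqxx mulr1n.
    move: Y0 => /matrixP/(_ 0 0); rewrite -colE [LHS]mxE [RHS]mxE
      [delta_mx _ _ _ _]mxE.
    by rewrite eqxx mulr1 => <-; congr (fun_of_matrix Y _ _); apply: val_inj.
  - apply/matrixP => i j; rewrite !ord1 mxE mxE [RHS]mxE.
    move: Y0r => /matrixP/(_ 0 (rshift 1 j)); rewrite -rowE [LHS]mxE [RHS]mxE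
      [delta_mx _ _ _ _]mxE.
    by rewrite mulr0 => <-; congr (fun_of_matrix Y _ _); apply: val_inj.
  - apply/matrixP => i j; rewrite !ord1 mxE mxE [RHS]mxE.
    move: Y0 => /matrixP/(_ (rshift 1 i) 0); rewrite -colE [LHS]mxE [RHS]mxE
      [delta_mx _ _ _ _]mxE.
    by rewrite mulr0 => <-; congr (fun_of_matrix Y _ _); apply: val_inj.
have [r [P [f [Q [[oP oQ f0 fm XE] fr]]]]] := IHm n (drsubmx Y).
pose F i := if i is i'.+1 then f i' else s.
pose bP : 'M_m.+1 := block_mx (1%:M : 'M_1) 0 0 P.
pose bQ : 'M_n.+1 := block_mx (1%:M : 'M_1) 0 0 Q.
have sE : sdiag (1 + m) (1 + n) F = block_mx (s%:M : 'M_1) 0 0 (sdiag m n f).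
  apply/matrixP => i j; rewrite -(@splitK 1 m i) -(@splitK 1 n j).
  case: (@split 1 m i) => i'; case: (@split 1 n j) => j'; rewrite [LHS]mxE /=.
  - by rewrite block_mxEul !ord1 mxE.
  - by rewrite block_mxEur !ord1 mxE.
  - by rewrite block_mxEdl !ord1 mxE.
  - by rewrite block_mxEdr mxE add1n eqSS.
have bYE : Y = bP *m sdiag m.+1 n.+1 F *m bQ^T.
  transitivity (block_mx (1%:M : 'M_1) 0 0 P *m sdiag (1 + m) (1 + n) F *m
    (block_mx (1%:M : 'M_1) 0 0 Q)^T); last by [].
  rewrite sE tr_block_mx !trmx0 trmx1 !mulmx_block.
  by rewrite !mulmx0 !mul0mx !addr0 !add0r !mul1mx mulmx1 !mul0mx YE XE.
exists r.+1, (P0 *m bP), F, (Q0 *m bQ); split; last by case.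
split.
- by apply: orthogonal_mulmx => //; exact: orthogonal_block1.
- by apply: orthogonal_mulmx => //; exact: orthogonal_block1.
- by case=> [|i] /=; [exact: ltW|exact: f0].
- by case=> [|i]; rewrite minnSS // ltnS; exact: fm.
have -> : X = P0 *m Y *m Q0^T.
  by rewrite /Y !mulmxA orthogonal_mxC // mul1mx -mulmxA orthogonal_mxC // mulmx1.
by rewrite bYE trmx_mul !mulmxA.
Qed.

(** * Scalar inequalities: Young, Hoelder, Bernoulli, Jensen *)

Lemma weighted_young (R : realType) (a b s t : R) : 0 <= a -> 0 <= b ->
  0 < s -> 0 < t -> s + t = 1 -> a `^ s * b `^ t <= s * a + t * b.
Proof.
move=> a0 b0 s0 t0 st; have := @conjugate_powR R (a `^ s) (b `^ t) s^-1 t^-1.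
rewrite !powR_ge0 !invr_gt0 !invrK => /(_ isT isT s0 t0 st).
by rewrite -!powRrM !mulfV ?gt_eqF // !powRr1 // mulrC (mulrC b) [_ * s]mulrC.
Qed.

(** Divide each family by its sum and add up Young's inequality over [i]. A family with zero sum
    vanishes identically and is treated first. *)
Lemma hoelder_sum (R : realType) (I : finType) (x y : I -> R) (s t : R) :
  (forall i, 0 <= x i) -> (forall i, 0 <= y i) -> 0 < s -> 0 < t -> s + t = 1 ->
  \sum_i x i `^ s * y i `^ t <= (\sum_i x i) `^ s * (\sum_i y i) `^ t.
Proof.
move=> x0 y0 s0 t0 st.
have sum0 (z : I -> R) : (forall i, 0 <= z i) -> \sum_i z i = 0 -> forall i, z i = 0.
  by move=> z0 zs i; exact: (psumr_eq0P (fun i _ => z0 i) zs).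
have [sx0|sx0] := eqVneq (\sum_i x i) 0.
  rewrite big1 => [|i _]; first by rewrite mulr_ge0 // powR_ge0.
  by rewrite (sum0 _ x0 sx0) powR0 ?mul0r ?gt_eqF.
have [sy0|sy0] := eqVneq (\sum_i y i) 0.
  rewrite big1 => [|i _]; first by rewrite mulr_ge0 // powR_ge0.
  by rewrite (sum0 _ y0 sy0) powR0 ?mulr0 ?gt_eqF.
set X := \sum_i x i; set Y := \sum_i y i.
have X0 : 0 < X by rewrite lt_def sx0 sumr_ge0.
have Y0 : 0 < Y by rewrite lt_def sy0 sumr_ge0.
have split z Z r : 0 <= z -> 0 < Z -> z `^ r = Z `^ r * (z / Z) `^ r :> R.
  move=> z0 Z0; have Zge0 := ltW Z0.
  by rewrite -powRM ?divr_ge0 // mulrC divfK // gt_eqF.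
rewrite -[leRHS]mulr1 -st.
have -> : s + t = \sum_i (s * (x i / X) + t * (y i / Y)).
  rewrite big_split /= -!mulr_sumr -!mulr_suml -/X -/Y.
  by rewrite !divff ?mulr1 // gt_eqF.
rewrite mulr_sumr; apply: ler_sum => i _.
rewrite (split (x i) X) // (split (y i) Y) // mulrACA.
rewrite ler_wpM2l ?mulr_ge0 ?powR_ge0 //.
by apply: weighted_young => //; rewrite divr_ge0 // ltW.
Qed.

Lemma powR_bernoulli (R : realType) (x r : R) :
  0 <= x -> 1 <= r -> 1 + r * (x - 1) <= x `^ r.
Proof.
move=> x0; rewrite le_eqVlt => /predU1P[<-|r1].
  by rewrite powRr1 // mul1r addrC subrK.
have r0 : 0 < r by lra.
have := @weighted_young R (x `^ r) 1 r^-1 (1 - r^-1) (powR_ge0 _ _) ler01.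
rewrite -powRrM mulfV ?gt_eqF // powRr1 // powR1 !mulr1 invr_gt0 r0.
rewrite subr_gt0 invf_lt1 // r1 => /(_ isT isT).
rewrite addrC subrK => /(_ erefl) xle.
have := ler_wpM2l (ltW r0) xle.
rewrite mulrDr mulrA mulrBr !mulfV ?gt_eqF //; lra.
Qed.

(** Average the tangent bound at the points [a i / M], where [M] is the weighted mean: the linear
    terms cancel. *)
Lemma jensen_powR_ge1 (R : realType) (I : finType) (w a : I -> R) (r : R) :
  (forall i, 0 <= w i) -> \sum_i w i = 1 -> (forall i, 0 <= a i) -> 1 <= r ->
  (\sum_i w i * a i) `^ r <= \sum_i w i * a i `^ r.
Proof.
move=> w0 w1 a0 r1; set M := \sum_i _.
have M0 : 0 <= M by apply: sumr_ge0 => i _; exact: mulr_ge0.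
have [ME|Mn0] := eqVneq M 0.
  rewrite ME powR0; last by rewrite gt_eqF //; lra.
  by apply: sumr_ge0 => i _; rewrite mulr_ge0 // powR_ge0.
have Mp : 0 < M by rewrite lt_def Mn0.
rewrite -[leLHS]mulr1.
have -> : 1 = \sum_i w i * (1 + r * (a i / M - 1)).
  under eq_bigr do rewrite mulrDr mulr1 mulrCA mulrBr mulr1 mulrA.
  by rewrite big_split /= w1 -mulr_sumr sumrB -mulr_suml -/M w1 divff // subrr mulr0 addr0.
rewrite mulr_sumr; apply: ler_sum => i _; rewrite mulrCA.
apply: ler_wpM2l => //.
have -> : a i `^ r = M `^ r * (a i / M) `^ r.
  by rewrite -powRM ?divr_ge0 // mulrC divfK.
by rewrite ler_wpM2l ?powR_ge0 // powR_bernoulli // divr_ge0.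
Qed.

Lemma jensen_powR_le1 (R : realType) (I : finType) (w a : I -> R) (r : R) :
  (forall i, 0 <= w i) -> \sum_i w i = 1 -> (forall i, 0 <= a i) ->
  0 < r -> r <= 1 ->
  \sum_i w i * a i `^ r <= (\sum_i w i * a i) `^ r.
Proof.
move=> w0 w1 a0 r0 r1.
have := @jensen_powR_ge1 R I w (fun i => a i `^ r) r^-1 w0 w1.
rewrite invf_ge1 // r1 => /(_ (fun i => powR_ge0 _ _) isT) /=.
under [X in _ <= X -> _]eq_bigr do rewrite -powRrM mulfV ?gt_eqF // powRr1 //.
have S0 : 0 <= \sum_i w i * a i `^ r.
  by apply: sumr_ge0 => i _; rewrite mulr_ge0 ?powR_ge0.
move=> /(ge0_ler_powR (ltW r0)); rewrite -powRrM mulVf ?gt_eqF // powRr1 //.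
apply; rewrite nnegrE ?powR_ge0 //.
by apply: sumr_ge0 => i _; rewrite mulr_ge0.
Qed.

(** * Doubly stochastic averaging and column norms *)

Lemma orthogonal_row_sqr (R : comUnitRingType) n (C : 'M[R]_n) i :
  orthogonal_mx C -> \sum_j C i j ^+ 2 = 1.
Proof.
move=> /orthogonal_mxC/matrixP/(_ i i); rewrite !mxE eqxx mulr1n => <-.
by apply: eq_bigr => j _; rewrite mxE expr2.
Qed.

Lemma orthogonal_col_sqr (R : comUnitRingType) n (C : 'M[R]_n) j :
  orthogonal_mx C -> \sum_i C i j ^+ 2 = 1.
Proof.
move=> /orthogonal_trmx/(orthogonal_row_sqr j) <-.
by apply: eq_bigr => i _; rewrite mxE.
Qed.

(** The squared entries of [C] are doubly stochastic: row sums equal to 1 allow Jensen in each row,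
    and column sums equal to 1 restore the plain sum after exchanging summations. *)
Lemma sum_powR_le_orthogonal (R : realType) n (C : 'M[R]_n) (a : 'I_n -> R) (r : R) :
  orthogonal_mx C -> (forall i, 0 <= a i) -> 0 < r -> r <= 1 ->
  \sum_i a i `^ r <= \sum_i (\sum_j C i j ^+ 2 * a j) `^ r.
Proof.
move=> oC a0 r0 r1; apply: (@le_trans _ _ (\sum_i \sum_j C i j ^+ 2 * a j `^ r)).
  rewrite exchange_big /=; apply: ler_sum => j _.
  by rewrite -mulr_suml orthogonal_col_sqr // mul1r.
apply: ler_sum => i _; apply: jensen_powR_le1 => // [j|]; first exact: sqr_ge0.
exact: orthogonal_row_sqr.
Qed.

Lemma sum_powR_ge_orthogonal (R : realType) n (C : 'M[R]_n) (a : 'I_n -> R) (r : R) :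
  orthogonal_mx C -> (forall i, 0 <= a i) -> 1 <= r ->
  \sum_i (\sum_j C i j ^+ 2 * a j) `^ r <= \sum_i a i `^ r.
Proof.
move=> oC a0 r1; apply: (@le_trans _ _ (\sum_i \sum_j C i j ^+ 2 * a j `^ r)).
  apply: ler_sum => i _; apply: jensen_powR_ge1 => // [j|]; first exact: sqr_ge0.
  exact: orthogonal_row_sqr.
rewrite exchange_big /=; apply: ler_sum => j _.
by rewrite -mulr_suml orthogonal_col_sqr // mul1r.
Qed.

Lemma sum_ord_trunc (V : nmodType) k n (h : nat -> V) :
  (k <= n)%N -> (forall i, (k <= i)%N -> h i = 0) ->
  \sum_(i < n) h i = \sum_(i < k) h i.
Proof.
move=> kn h0; rewrite -!(big_mkord xpredT h) (big_cat_nat (leq0n k) kn) /=.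
by rewrite [X in _ + X]big_nat_cond [X in _ + X]big1 ?addr0 // => i /andP[/andP[/h0]].
Qed.

(** Both sides are the [i]-th diagonal entry of the Gram matrix of [X *m B], in which [P]
    cancels. *)
Lemma svd_col_sqr (R : numDomainType) m n (X : 'M[R]_(m, n)) P f Q (B : 'M_n) i :
  is_svd X P f Q ->
  \sum_k (X *m B) k i ^+ 2 = \sum_j (B^T *m Q) i j ^+ 2 * f j ^+ 2.
Proof.
case=> oP oQ f0 fm ->.
have -> : \sum_k (P *m sdiag m n f *m Q^T *m B) k i ^+ 2 =
   ((P *m sdiag m n f *m Q^T *m B)^T *m (P *m sdiag m n f *m Q^T *m B)) i i.
  by rewrite [RHS]mxE; apply: eq_bigr => k _; rewrite [in RHS]mxE expr2.
have -> : (P *m sdiag m n f *m Q^T *m B)^T *m (P *m sdiag m n f *m Q^T *m B) =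
   (B^T *m Q) *m sdiag n n (fun i => f i * f i) *m (B^T *m Q)^T.
  rewrite -(@mul_sdiag _ n m n f f) => [|j mj]; last first.
    by rewrite fm ?mulr0 // (leq_trans (geq_minl _ _)).
  by rewrite !trmx_mul !trmxK tr_sdiag !mulmxA -(mulmxA _ P^T) oP mulmx1.
rewrite mxE; apply: eq_bigr => j _.
by rewrite mul_mx_sdiag [(_^T) _ _]mxE mulrAC !expr2.
Qed.

Lemma powR_sqr_half (R : realType) (x q : R) :
  0 <= x -> (x ^+ 2) `^ (q / 2) = x `^ q.
Proof. by move=> x0; rewrite -powR_mulrn // -powRrM mulrC divfK // pnatr_eq0. Qed.

Lemma svd_psum_le_col (R : realType) m n (X : 'M[R]_(m, n)) P f Q (B : 'M_n) (q : R) :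
  is_svd X P f Q -> orthogonal_mx B -> 0 < q -> q <= 2 ->
  \sum_(j < n) f j `^ q <= \sum_j (\sum_k (X *m B) k j ^+ 2) `^ (q / 2).
Proof.
move=> svdX oB q0 q2; have [_ oQ f0 _ _] := svdX.
have := @sum_powR_le_orthogonal R n (B^T *m Q) (fun j => f j ^+ 2) (q / 2).
under eq_bigr do rewrite powR_sqr_half //.
under [X in _ -> _ -> _ -> _ -> _ <= X]eq_bigr do rewrite -(svd_col_sqr _ _ svdX).
apply; [|by move=> j; exact: sqr_ge0|lra|lra].
by apply: orthogonal_mulmx => //; exact: orthogonal_trmx.
Qed.

Lemma svd_psum_ge_col (R : realType) m n (X : 'M[R]_(m, n)) P f Q (B : 'M_n) (q : R) :
  is_svd X P f Q -> orthogonal_mx B -> 2 <= q ->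
  \sum_j (\sum_k (X *m B) k j ^+ 2) `^ (q / 2) <= \sum_(j < n) f j `^ q.
Proof.
move=> svdX oB q2; have [_ oQ f0 _ _] := svdX.
have := @sum_powR_ge_orthogonal R n (B^T *m Q) (fun j => f j ^+ 2) (q / 2).
under [X in _ -> _ -> _ -> _ <= X]eq_bigr do rewrite powR_sqr_half //.
under [X in _ -> _ -> _ -> X <= _]eq_bigr do rewrite -(svd_col_sqr _ _ svdX).
apply; [|by move=> j; exact: sqr_ge0|lra].
by apply: orthogonal_mulmx => //; exact: orthogonal_trmx.
Qed.

Lemma svd_col_self (R : realType) m n (X : 'M[R]_(m, n)) P f Q (q : R) :
  is_svd X P f Q ->
  \sum_j (\sum_k (X *m Q) k j ^+ 2) `^ (q / 2) = \sum_(j < n) f j `^ q.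
Proof.
move=> svdX; have [_ oQ f0 _ _] := svdX.
apply: eq_bigr => j _; rewrite (svd_col_sqr _ _ svdX) oQ (bigD1 j) //= big1.
  by rewrite mxE eqxx expr1n mul1r addr0 powR_sqr_half.
by move=> i ij; rewrite mxE eq_sym (negbTE ij) expr0n mul0r.
Qed.

(** Measured in the basis [Q'], the columns of [X] give exactly the power sum of [f'], and the
    column bound compares it with that of [f]. Exchanging the two decompositions gives the reverse
    inequality. *)
Lemma svd_psum_unique (R : realType) m n (X : 'M[R]_(m, n)) P f Q P' f' Q' (q : R) :
  is_svd X P f Q -> is_svd X P' f' Q' -> 0 < q ->
  \sum_(j < n) f j `^ q = \sum_(j < n) f' j `^ q.
Proof.
move=> svdX svdX' q0; have [_ oQ _ _ _] := svdX; have [_ oQ' _ _ _] := svdX'.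
have [q2|/ltW q2] := leP q 2; apply/eqP; rewrite eq_le.
  rewrite -{1}(svd_col_self _ svdX') -{2}(svd_col_self _ svdX).
  by rewrite (svd_psum_le_col svdX oQ') // (svd_psum_le_col svdX' oQ).
rewrite -{1}(svd_col_self _ svdX) -{2}(svd_col_self _ svdX').
by rewrite (svd_psum_ge_col svdX' oQ) // (svd_psum_ge_col svdX oQ').
Qed.

(** * Schatten norms from an arbitrary decomposition *)

Definition ext0 (R : nmodType) k (s : 'I_k -> R) (i : nat) : R :=
  if @insub _ (fun j => (j < k)%N) 'I_k i is Some j then s j else 0.

Lemma ext0_ord (R : nmodType) k (s : 'I_k -> R) (i : 'I_k) : ext0 s i = s i.
Proof. by rewrite /ext0 valK. Qed.

Lemma ext0_out (R : nmodType) k (s : 'I_k -> R) i : (k <= i)%N -> ext0 s i = 0.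
Proof. by move=> ki; rewrite /ext0 insubF // ltnNge ki. Qed.

Lemma ext0_ge0 (R : numDomainType) k (s : 'I_k -> R) i :
  (forall j, 0 <= s j) -> 0 <= ext0 s i.
Proof. by rewrite /ext0; case: insub. Qed.

Lemma rdiag_mxE (R : pzRingType) m n (s : 'I_(minn m n) -> R) :
  rdiag_mx s = sdiag m n (ext0 s).
Proof. by apply/matrixP => i j; rewrite !mxE; case: eqP. Qed.

(** Existence of a decomposition rules out the default branch of [svals]; [ext0] pads the chosen
    values by zeros. *)
Lemma svals_svd (R : realType) m n (X : 'M[R]_(m, n)) :
  exists P Q, is_svd X P (ext0 (svals X)) Q.
Proof.
have : exists s, svals_spec X s.
  have [r [P [f [Q [[oP oQ f0 fm XE] _]]]]] := svd_exists X.
  exists (fun i => f i); split=> //; exists P, Q; split=> //; split=> //.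
  rewrite {1}XE rdiag_mxE; congr (_ *m _ *m _); apply: eq_sdiag => k km.
  by rewrite -[k]/(val (Ordinal km)) ext0_ord.
rewrite /svals; case: pselect => // exs _; case: cid => s /= [s0 [P [Q [oP [oQ XE]]]]].
exists P, Q; split=> //; first by move=> i; exact: ext0_ge0.
  by move=> i; exact: ext0_out.
by rewrite -rdiag_mxE.
Qed.

Lemma schattenE (R : realType) m n (X : 'M[R]_(m, n)) P f Q (q : R) :
  is_svd X P f Q -> 0 < q -> schatten q X = (\sum_(j < n) f j `^ q) `^ (1 / q).
Proof.
move=> svdX q0; have [P' [Q' svdX']] := svals_svd X.
rewrite (svd_psum_unique svdX svdX' q0) /schatten; congr (_ `^ _).
rewrite (@sum_ord_trunc _ (minn m n) n (fun i => ext0 (svals X) i `^ q)) ?geq_minr //.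
  by apply: eq_bigr => i _; rewrite ext0_ord.
by move=> i mi; rewrite ext0_out // powR0 ?gt_eqF.
Qed.

Lemma schatten_ge0 (R : realType) m n (X : 'M[R]_(m, n)) (q : R) : 0 <= schatten q X.
Proof. exact: powR_ge0. Qed.

Lemma schatten_powE (R : realType) m n (X : 'M[R]_(m, n)) P f Q (q : R) :
  is_svd X P f Q -> 0 < q -> schatten q X `^ q = \sum_(j < n) f j `^ q.
Proof.
move=> svdX q0; rewrite (schattenE svdX) // -powRrM mulrC mul1r mulfV ?gt_eqF //.
by rewrite powRr1 // sumr_ge0 // => i _; exact: powR_ge0.
Qed.

Lemma svd_psum_minn (R : realType) m n (X : 'M[R]_(m, n)) P f Q (q : R) :
  is_svd X P f Q -> 0 < q -> \sum_(j < n) f j `^ q = \sum_(j < minn m n) f j `^ q.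
Proof.
move=> [_ _ _ fm _] q0.
rewrite (@sum_ord_trunc _ (minn m n) n (fun i => f i `^ q)) ?geq_minr //.
by move=> i mi; rewrite fm // powR0 ?gt_eqF.
Qed.

Lemma schatten_tr (R : realType) m n (X : 'M[R]_(m, n)) (q : R) :
  0 < q -> schatten q X^T = schatten q X.
Proof.
move=> q0; have [P [Q svdX]] := svals_svd X; have svdXT := is_svd_tr svdX.
rewrite (schattenE svdX q0) (schattenE svdXT q0) (svd_psum_minn svdX q0).
by rewrite (svd_psum_minn svdXT q0) minnC.
Qed.

Lemma mul_mx_sdiag_ext0 (R : pzRingType) m k n (A : 'M[R]_(m, k)) f i (j : 'I_n) :
  (A *m sdiag k n f) i j = ext0 (A i) j * f j.
Proof.
rewrite mxE; under eq_bigr do rewrite mxE.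
have [jk|kj] := ltnP j k.
  rewrite (bigD1 (Ordinal jk)) //= eqxx big1 ?addr0; last first.
    by move=> l lj; rewrite [l == j :> nat](_ : _ = false) ?mulr0 //; exact: negbTE.
  by rewrite -[nat_of_ord j in RHS]/(val (Ordinal jk)) ext0_ord.
rewrite ext0_out // mul0r big1 // => l _.
by rewrite ltn_eqF ?mulr0 // (leq_trans _ kj).
Qed.

(** * Hoelder's inequality for Schatten norms *)

Lemma powR_eq_mul (R : realType) (x s t u : R) :
  s + t = u -> u != 0 -> x `^ s * x `^ t = x `^ u.
Proof. by move=> <- u0; rewrite powRD // (negbTE u0). Qed.

Lemma le_of_powR (R : realType) (x y r : R) :
  0 < r -> 0 <= x -> 0 <= y -> x `^ r <= y `^ r -> x <= y.
Proof.
move=> r0 x0 y0 xy.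
have r'0 : 0 <= r^-1 by rewrite invr_ge0 ltW.
have := ge0_ler_powR r'0 _ _ xy; rewrite !nnegrE !powR_ge0 => /(_ isT isT).
by rewrite -!powRrM mulfV ?gt_eqF // !powRr1.
Qed.

Lemma schatten_mul_le2 (R : realType) m k n (W : 'M[R]_(m, k)) (Y : 'M_(k, n))
  (p q r : R) : 0 < p -> p <= 2 -> 2 <= q -> 0 < r -> q^-1 + r^-1 = p^-1 ->
  schatten p (W *m Y) <= schatten q W * schatten r Y.
Proof.
move=> p0 p2 q2 r0 qrp; have q0 : 0 < q by lra.
have [Pz [Qz svdZ]] := svals_svd (W *m Y).
have [Pw [Qw svdW]] := svals_svd W.
have [A [B svdY]] := svals_svd Y; set f := ext0 _ in svdY.
have [oA oB f0 fm YE] := svdY.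
(* The squared column norms of [W *m A], padded by zeros from [k] on. As [A] and [B] come from the
   decomposition of [Y], column [j] of [W *m Y *m B] is [f j] times column [j] of [W *m A]. *)
pose N := ext0 (fun l => \sum_i (W *m A) i l ^+ 2).
have N0 i : 0 <= N i by apply: ext0_ge0 => l; apply: sumr_ge0 => *; exact: sqr_ge0.
apply: (le_of_powR p0); rewrite ?mulr_ge0 ?schatten_ge0 //.
rewrite (schatten_powE svdZ p0); apply: le_trans (svd_psum_le_col svdZ oB p0 p2) _.
have -> : \sum_j (\sum_i (W *m Y *m B) i j ^+ 2) `^ (p / 2) =
    \sum_(j < n) N j `^ (p / 2) * f j `^ p.
  apply: eq_bigr => j _; rewrite -(powR_sqr_half p (f0 j)) -powRM ?sqr_ge0 //.
  congr (_ `^ _); rewrite YE !mulmxA -!mulmxA oB mulmx1 mulmxA.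
  under eq_bigr do rewrite mul_mx_sdiag_ext0 exprMn.
  rewrite -mulr_suml; congr (_ * _); rewrite /N /ext0.
  by case: insub => // ; rewrite big1 // => *; rewrite expr0n.
rewrite (@sum_ord_trunc _ (minn k n) n (fun j => N j `^ (p / 2) * f j `^ p)) ?geq_minr //;
  last by move=> i mi; rewrite fm // powR0 ?mulr0 ?gt_eqF.
have -> : \sum_(j < minn k n) N j `^ (p / 2) * f j `^ p =
    \sum_(j < minn k n) (N j `^ (q / 2)) `^ (p / q) * (f j `^ r) `^ (p / r).
  apply: eq_bigr => j _; rewrite -!powRrM; congr (_ `^ _ * _ `^ _).
    by field; rewrite gt_eqF.
  by field; rewrite gt_eqF.
apply: le_trans (hoelder_sum _ _ _ _ _) _ => [j|j||||]; rewrite ?powR_ge0 ?divr_gt0 //.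
  by rewrite -mulrDr qrp mulfV ?gt_eqF.
rewrite powRM ?schatten_ge0 //; apply: ler_pM; rewrite ?powR_ge0 //; last first.
  rewrite -(svd_psum_minn svdY r0) -(schatten_powE svdY r0) -powRrM.
  by rewrite mulrC divfK ?gt_eqF.
have -> : schatten q W `^ p = (schatten q W `^ q) `^ (p / q).
  by rewrite -powRrM mulrC divfK ?gt_eqF.
apply: (ge0_ler_powR (ltW (divr_gt0 p0 q0))).
- by rewrite nnegrE sumr_ge0 // => j _; exact: powR_ge0.
- by rewrite nnegrE powR_ge0.
rewrite (schatten_powE svdW q0); apply: le_trans _ (svd_psum_ge_col svdW oA q2).
(* The sum stops at [minn k n], while the column bound for [W] runs up to [k]; the missing terms are
   nonnegative. *)
pose h j := if (j < minn k n)%N then N j `^ (q / 2) else 0.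
have -> : \sum_(j < minn k n) N j `^ (q / 2) = \sum_(j < k) h j.
  rewrite (@sum_ord_trunc _ (minn k n) k h) ?geq_minl // => [|i mi].
    by apply: eq_bigr => j _; rewrite /h ltn_ord.
  by rewrite /h ltnNge mi.
apply: ler_sum => j _; rewrite /h /N ext0_ord.
by case: ifP => // _; exact: powR_ge0.
Qed.

Lemma powR_svd (R : realType) k l P (f : nat -> R) Q (s : R) :
  orthogonal_mx P -> orthogonal_mx Q -> 0 < s ->
  (forall i, (minn k l <= i)%N -> f i = 0) ->
  is_svd (P *m sdiag k l (fun i => f i `^ s) *m Q^T) P (fun i => f i `^ s) Q.
Proof.
move=> oP oQ s0 fkl; split=> // i; first exact: powR_ge0.
by move=> /fkl ->; rewrite powR0 ?gt_eqF.
Qed.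

Lemma schatten_split (R : realType) m k (U : 'M[R]_(m, k)) (p q r : R) :
  0 < p -> 0 < q -> 0 < r -> q^-1 + r^-1 = p^-1 ->
  exists (W : 'M[R]_(m, k)) (Y : 'M[R]_k),
    U = W *m Y /\ schatten q W * schatten r Y = schatten p U.
Proof.
move=> p0 q0 r0 qrp; have [P [Q svdU]] := svals_svd U; set f := ext0 _ in svdU.
have [oP oQ f0 fm UE] := svdU.
have pq : p / q + p / r = 1 by rewrite -mulrDr qrp mulfV ?gt_eqF.
have fk i : (minn k k <= i)%N -> f i = 0.
  by rewrite minnn => ki; rewrite fm // (leq_trans (geq_minr _ _)).
have svdW := powR_svd oP (orthogonal_mx1 R k) (divr_gt0 p0 q0) fm.
have svdY := powR_svd (orthogonal_mx1 R k) oQ (divr_gt0 p0 r0) fk.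
exists (P *m sdiag m k (fun i => f i `^ (p / q)) *m 1%:M^T).
exists (1%:M *m sdiag k k (fun i => f i `^ (p / r)) *m Q^T); split.
  rewrite UE trmx1 mulmx1 mul1mx !mulmxA; congr (_ *m _); rewrite -mulmxA.
  rewrite mul_sdiag => [|i ki].
    congr (_ *m _); apply: eq_sdiag => i _.
    by rewrite (powR_eq_mul _ pq) ?oner_eq0 // powRr1.
  by rewrite fk ?minnn // powR0 ?mul0r // gt_eqF // divr_gt0.
rewrite (schattenE svdW q0) (schattenE svdY r0) (schattenE svdU p0).
under eq_bigr do rewrite -powRrM divfK ?gt_eqF //.
under [X in _ * X `^ _]eq_bigr do rewrite -powRrM divfK ?gt_eqF //.
by apply: powR_eq_mul; rewrite !div1r // invr_eq0 gt_eqF.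
Qed.

(* Splitting [U = W Y] with [|W|_(N p1)] a fractional power of [|U|_p1] lets the
   exponent-at-least-2 case peel off [W]; the rest is the same claim for [N - 1]. *)
Lemma schatten_mul_le_small (R : realType) N m k n (U : 'M[R]_(m, k))
  (V : 'M_(k, n)) (p p1 p2 : R) :
  0 < p -> 0 < p1 -> 0 < p2 -> p1^-1 + p2^-1 = p^-1 ->
  p2 <= 2 -> 2 <= N.+1%:R * p1 ->
  schatten p (U *m V) <= schatten p1 U * schatten p2 V.
Proof.
elim: N m k n U V p p1 => [|N IHN] m k n U V p p1 p0 p10 p20 pE p22 Np1.
  rewrite mul1r in Np1; apply: schatten_mul_le2 => //; apply: le_trans _ p22.
  by rewrite -[leLHS]invrK -[leRHS]invrK lef_pV2 ?posrE ?invr_gt0 // -pE lerDr invr_ge0 ltW.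
(* [M] stands for [N.+2%:R] as an opaque real, convenient for [field] and [lra]. *)
have [M ME] : exists M : R, M = N.+2%:R by exists N.+2%:R.
have M1 : 1 < M by rewrite ME ltr1n.
have M0 : 0 < M by lra.
have M10 : M - 1 = N.+1%:R by rewrite ME -natr1 addrK.
rewrite -ME in Np1.
have M1p : 0 < M - 1 by rewrite subr_gt0.
(* By assumption [q] is at least 2. The complementary exponent [r1] satisfies
   [(M - 1) * r1 = M * p1], which is exactly the bound the induction hypothesis asks for. *)
pose q := M * p1; pose r1 := M * p1 / (M - 1).
have q0 : 0 < q by rewrite mulr_gt0.
have r10 : 0 < r1 by rewrite divr_gt0.
have [W [Y [-> <-]]] : exists (W : 'M[R]_(m, k)) (Y : 'M[R]_k),
    U = W *m Y /\ schatten q W * schatten r1 Y = schatten p1 U.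
  apply: schatten_split => //; rewrite /q /r1; field.
  by rewrite !gt_eqF.
(* The exponent for [Y *m V], chosen so that [q^-1 + r^-1 = p^-1]. *)
pose r := (r1^-1 + p2^-1)^-1.
have rV : r^-1 = r1^-1 + p2^-1 by rewrite invrK.
have r0 : 0 < r by rewrite invr_gt0 addr_gt0 ?invr_gt0.
rewrite -mulmxA -mulrA; apply: (@le_trans _ _ (schatten q W * schatten r (Y *m V))).
  apply: schatten_mul_le2 => //.
    apply: le_trans _ p22; rewrite -[leLHS]invrK -[leRHS]invrK.
    by rewrite lef_pV2 ?posrE ?invr_gt0 // -pE lerDr invr_ge0 ltW.
  rewrite rV -pE /q /r1; field.
  by rewrite !gt_eqF.
rewrite ler_wpM2l ?schatten_ge0 //; apply: IHN => //.
by rewrite -M10 /r1 mulrC divfK ?gt_eqF.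
Qed.

Lemma schatten_mul_le (R : realType) m k n (U : 'M[R]_(m, k)) (V : 'M_(k, n))
  (p p1 p2 : R) :
  0 < p -> p <= 2 -> 0 < p1 -> 0 < p2 -> p1^-1 + p2^-1 = p^-1 ->
  schatten p (U *m V) <= schatten p1 U * schatten p2 V.
Proof.
move=> p0 p_le2 p10 p20 pE; have [p22|/ltW p22] := leP p2 2.
  (* Any number of peeling steps exceeding [2 / p1] after adding one is enough. *)
  apply: (@schatten_mul_le_small _ (Num.truncn (2 / p1))) => //.
  rewrite -ler_pdivrMr //; exact/ltW/truncnS_gt.
rewrite -schatten_tr // trmx_mul mulrC -(schatten_tr U) // -(schatten_tr V) //.
by apply: schatten_mul_le2 => //; rewrite addrC.
Qed.

(** * Optimal factors through the inner dimension [d] *)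

Lemma svd_rank (R : numFieldType) m n (X : 'M[R]_(m, n)) P f Q r :
  is_svd X P f Q -> (forall i, (f i != 0) = (i < r)%N) -> \rank X = r.
Proof.
case=> oP oQ f0 fm -> fr.
have rmn : (r <= minn m n)%N by rewrite leqNgt -fr fm ?eqxx.
rewrite mxrankMfree; last by rewrite row_free_unit unitmx_tr orthogonal_mx_unit.
rewrite eqmxMfull; last by rewrite row_full_unit orthogonal_mx_unit.
by move: rmn; rewrite leq_min => /andP[rm rn]; exact: mxrank_sdiag.
Qed.

Lemma schatten_factor_attained (R : realType) m n d (X : 'M[R]_(m, n)) (p p1 p2 : R) :
  (\rank X <= d)%N -> 0 < p -> 0 < p1 -> 0 < p2 -> p1^-1 + p2^-1 = p^-1 ->
  exists (U : 'M_(m, d)) (V : 'M_(n, d)), [/\ X = U *m V^T,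
    schatten p1 U `^ p1 = schatten p X `^ p & schatten p2 V `^ p2 = schatten p X `^ p].
Proof.
move=> rd p0 p10 p20 pE; have [r [P [f [Q [svdX fr]]]]] := svd_exists X.
have rE := svd_rank svdX fr; have [oP oQ f0 fm XE] := svdX.
have fd i : (d <= i)%N -> f i = 0.
  by move=> di; apply/eqP; rewrite -[_ == _]negbK fr -leqNgt -rE (leq_trans rd).
have fmd i : (minn m d <= i)%N -> f i = 0.
  rewrite geq_min => /orP[mi|/fd //]; apply: fm.
  exact: leq_trans (geq_minl _ _) mi.
have fnd i : (minn n d <= i)%N -> f i = 0.
  rewrite geq_min => /orP[ni|/fd //]; apply: fm.
  exact: leq_trans (geq_minr _ _) ni.
have pp : p / p1 + p / p2 = 1 by rewrite -mulrDr pE mulfV ?gt_eqF.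
have svdU := powR_svd oP (orthogonal_mx1 R d) (divr_gt0 p0 p10) fmd.
have svdV := powR_svd oQ (orthogonal_mx1 R d) (divr_gt0 p0 p20) fnd.
have dn : \sum_(j < d) f j `^ p = \sum_(j < n) f j `^ p.
  have f0p i : f i = 0 -> f i `^ p = 0 by move=> ->; rewrite powR0 ?gt_eqF.
  have [le_dn|/ltnW le_nd] := leqP d n.
    by rewrite (@sum_ord_trunc _ d n (fun i => f i `^ p)) // => i /fd/f0p.
  rewrite (@sum_ord_trunc _ n d (fun i => f i `^ p)) // => i ni; apply/f0p/fm.
  exact: leq_trans (geq_minr _ _) ni.
exists (P *m sdiag m d (fun i => f i `^ (p / p1)) *m 1%:M^T).
exists (Q *m sdiag n d (fun i => f i `^ (p / p2)) *m 1%:M^T); split.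
- rewrite !trmx1 !mulmx1 trmx_mul tr_sdiag XE !mulmxA; congr (_ *m _).
  rewrite -mulmxA mul_sdiag => [|i /fd ->].
    congr (_ *m _); apply: eq_sdiag => i _.
    by rewrite (powR_eq_mul _ pp) ?oner_eq0 // powRr1.
  by rewrite powR0 ?mul0r // gt_eqF // divr_gt0.
- rewrite (schatten_powE svdU p10) (schatten_powE svdX p0) -dn.
  by apply: eq_bigr => j _; rewrite -powRrM divfK ?gt_eqF.
- rewrite (schatten_powE svdV p20) (schatten_powE svdX p0) -dn.
  by apply: eq_bigr => j _; rewrite -powRrM divfK ?gt_eqF.
Qed.

(** * Weighted means and the three minima *)

Lemma powR_root (R : realType) (x r : R) :
  r != 0 -> 0 <= x -> (x `^ r) `^ (1 / r) = x.
Proof. by move=> r0 x0; rewrite -powRrM div1r mulfV // powRr1. Qed.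

Lemma powR_eq_root (R : realType) (x y r s : R) :
  r != 0 -> 0 <= x -> x `^ r = y `^ s -> x = y `^ (s / r).
Proof. by move=> r0 x0 xy; rewrite powRrM -xy -div1r powR_root. Qed.

Lemma mul_le_weighted_mean (R : realType) (a b p p1 p2 : R) :
  0 <= a -> 0 <= b -> 0 < p -> 0 < p1 -> 0 < p2 -> p1^-1 + p2^-1 = p^-1 ->
  a * b <= (p / p1 * a `^ p1 + p / p2 * b `^ p2) `^ (1 / p).
Proof.
move=> a0 b0 p0 p10 p20 pE; have pn0 : p != 0 by rewrite gt_eqF.
have pp : p / p1 + p / p2 = 1 by rewrite -mulrDr pE mulfV.
have s0 := divr_gt0 p0 p10; have t0 := divr_gt0 p0 p20.
have pV0 : 0 <= 1 / p by rewrite div1r invr_ge0 ltW.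
rewrite -(powR_root pn0 (mulr_ge0 a0 b0)); apply: (ge0_ler_powR pV0).
- by rewrite nnegrE powR_ge0.
- by rewrite nnegrE addr_ge0 // mulr_ge0 ?powR_ge0 ?(ltW s0) ?(ltW t0).
apply: le_trans (weighted_young (powR_ge0 a p1) (powR_ge0 b p2) s0 t0 pp).
by rewrite -!powRrM ![_ * (p / _)]mulrC !divfK ?gt_eqF // powRM.
Qed.

Theorem theorem3 (R : realType) (m n d : nat) (X : 'M[R]_(m, n)) (p p1 p2 : R) :
  (\rank X <= d)%N ->
  0 < p -> p <= 1 -> 0 < p1 -> 0 < p2 -> p1^-1 + p2^-1 = p^-1 ->
  factor_min d X (fun U V => schatten p1 U * schatten p2 V) (schatten p X) /\
  factor_min d X
    (fun U V => ((p2 * schatten p1 U `^ p1 + p1 * schatten p2 V `^ p2)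
                 / (p1 + p2)) `^ (1 / p)) (schatten p X) /\
  factor_min d X
    (fun U V => ((schatten p1 U `^ p1 / p1 + schatten p2 V `^ p2 / p2)
                 / (1 / p)) `^ (1 / p)) (schatten p X).
Proof.
move=> rd p0 p_le1 p10 p20 pE.
have p_le2 : p <= 2 by lra.
have pn0 : p != 0 by rewrite gt_eqF.
have p1n0 : p1 != 0 by rewrite gt_eqF.
have p2n0 : p2 != 0 by rewrite gt_eqF.
have p12n0 : p1 + p2 != 0 by rewrite gt_eqF // addr_gt0.
have pp : p / p1 + p / p2 = 1 by rewrite -mulrDr pE mulfV.
have [U0 [V0 [X0 U0E V0E]]] := schatten_factor_attained rd p0 p10 p20 pE.
have mul_le (U : 'M[R]_(m, d)) (V : 'M[R]_(n, d)) : X = U *m V^T ->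
    schatten p X <= schatten p1 U * schatten p2 V.
  move=> ->; rewrite -(schatten_tr V p20).
  exact: (schatten_mul_le _ _ p0 p_le2 p10 p20 pE).
have mean_le (U : 'M[R]_(m, d)) (V : 'M[R]_(n, d)) : X = U *m V^T ->
    schatten p X <=
      (p / p1 * schatten p1 U `^ p1 + p / p2 * schatten p2 V `^ p2) `^ (1 / p).
  move=> /mul_le XUV; apply: le_trans XUV _.
  exact: (mul_le_weighted_mean (schatten_ge0 U p1) (schatten_ge0 V p2) p0 p10 p20 pE).
(* Solving for [p] shows that both quotients are the same mean with weights [p / p1] and
   [p / p2]. *)
have pE' : p = p1 * p2 / (p1 + p2).
  by rewrite -[p]invrK -pE; field; rewrite p1n0 p2n0 p12n0.
have form2 (a b : R) : (p2 * a + p1 * b) / (p1 + p2) = p / p1 * a + p / p2 * b.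
  by rewrite pE'; field; rewrite p1n0 p2n0 p12n0.
have form3 (a b : R) : (a / p1 + b / p2) / (1 / p) = p / p1 * a + p / p2 * b.
  by field; rewrite pn0 p1n0 p2n0.
have mean_att : (p / p1 * schatten p1 U0 `^ p1 + p / p2 * schatten p2 V0 `^ p2)
    `^ (1 / p) = schatten p X.
  by rewrite U0E V0E -mulrDl pp mul1r powR_root ?schatten_ge0.
split; [|split]; split.
- exists U0, V0; split; first exact: X0.
  rewrite (powR_eq_root p1n0 (schatten_ge0 _ _) U0E).
  rewrite (powR_eq_root p2n0 (schatten_ge0 _ _) V0E).
  rewrite (powR_eq_mul _ pp (oner_neq0 _)); exact: (powRr1 (schatten_ge0 X p)).
- exact: mul_le.
- by exists U0, V0; split; [exact: X0|rewrite form2].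
- by move=> U V XUV; rewrite form2; exact: mean_le.
- by exists U0, V0; split; [exact: X0|rewrite form3].
- by move=> U V XUV; rewrite form3; exact: mean_le.
Qed.
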